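(* Let $q$ be a prime number, let $G=\mathbb{Z}/q\mathbb{Z}$, and let $b\in G\setminus\{0\}$. Then $$\inf\left\{\prod_{x\in G\setminus\{0\}}\pi(x)\;:\;\pi\in\mathcal{M}_b(G)\right\}=\frac{(q-1)!}{(q-1)^{q-1}}.$$ Moreover, this infimum is attained uniquely by the function $\operatorname{GOM}^q_{q-1}\circ\phi$, where $\phi:G\to G$ is the (unique) group automorphism that sends $b$ to $q-1$.
   Context: For an abelian group $G$ and $b\in G\setminus\{0\}$, let $I_b(G)$ be the set of finite-support functions $y:G\to\mathbb{Z}_{\ge 0}$ with $\sum_{x\in G}y(x)\,x=b$. A function $\pi:G\to\mathbb{R}_+$ (nonnegative reals) is valid if $\sum_{x\in G}\pi(x)y(x)\ge 1$ for every $y\in I_b(G)$. A valid $\pi:G\to\mathbb{R}_+$ is minimal if every valid $\tilde\pi:G\to\mathbb{R}_+$ with $\tilde\pi\le\pi$ pointwise satisfies $\tilde\pi=\pi$. $\mathcal{M}_b(G)$ denotes the set of minimal functions. By a known theorem of Gomory and Johnson, $\pi:G\to\mathbb{R}_+$ belongs to $\mathcal{M}_b(G)$ if and only if $\pi(0)=0$, $\pi(x)+\pi(y)\ge\pi(x+y)$ for all $x,y\in G$, and $\pi(x)+\pi(b-x)=1$ for all $x\in G$. For $G=\mathbb{Z}/q\mathbb{Z}$, identify elements with their representatives in $\{0,\dots,q-1\}$. The function $\operatorname{GOM}^q_{q-1}:G\to\mathbb{R}_+$ is $\operatorname{GOM}^q_{q-1}(x)=\frac{x}{q-1}$, where $x$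 on the right is the representative in $\{0,\dots,q-1\}$. *)

(* Defs.v *)
From HB Require Import structures.
From mathcomp Require Import all_boot all_order all_algebra all_fingroup finmap.
From mathcomp Require Import boolp classical_sets reals.

Set Implicit Arguments.
Unset Strict Implicit.
Unset Printing Implicit Defensive.

Import Order.TTheory GRing.Theory Num.Theory.

Local Open Scope classical_set_scope.
Local Open Scope ring_scope.

(* Since [y] vanishes off its finite support [finsupp y], sums over all of [G]
   are written as sums over [finsupp y]. *)
Definition Isol (G : zmodType) (b : G) : set {fsfun G -> nat with 0%N} :=
  [set y | \sum_(x <- finsupp y) x *+ y x = b].

Definition valid (R : realType) (G : zmodType) (b : G) (pi : G -> R) : Prop :=
  (forall x, 0 <= pi x) /\
  (forall y, Isol b y -> 1 <= \sum_(x <- finsupp y) pi x * (y x)%:R).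

Definition minimal_functions (R : realType) (G : zmodType) (b : G) :
    set (G -> R) :=
  [set pi | valid b pi /\
    forall pi' : G -> R,
      valid b pi' -> (forall x, pi' x <= pi x) -> pi' = pi].

(* For [q >= 2] the type ['Z_q] is ['I_q], so the coercion to [nat] gives the
   representative in [{0, ..., q-1}]. *)
Definition GOM (R : realType) (q : nat) (x : 'Z_q) : R :=
  (nat_of_ord x)%:R / (q.-1)%:R.
Arguments GOM R q x : clear implicits.

(* Main.v *)
(* By the Gomory-Johnson characterization a minimal [pi] is subadditive with
   [pi x + pi (b - x) = 1].  Let [n = q - 1] and sort the values of [pi] as
   [0 = v_0 <= v_1 <= ... <= v_n].  Applying Cauchy-Davenport to the sublevel
   sets of [pi] shows that [v] is subadditive on [{0, ..., n}].  Hence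
   [S_k = v_1 + ... + v_k] satisfies [2 S_{k-1} >= (k - 1) v_k], i.e.
   [S_k / (k (k + 1))] is nonincreasing, and [S_n = (n + 1) / 2] by symmetry, so
   [S_k >= 1/n + 2/n + ... + k/n] with equality at [k = n]: the sequence [i / n]
   majorizes [v].  Abel summation then gives [\sum (i / n) / v_i <= n], and AM-GM
   gives [\prod (i / n) <= \prod v_i], with equality only for [v_i = i / n].
   In that case some [x] has [pi x = 1 / n], so [pi (k x) <= k / n] by
   subadditivity; both sides have the same sum over [k < q], so they agree. *)
Require Import Defs.
From HB Require Import structures.
From mathcomp Require Import all_boot all_order all_algebra all_fingroup finmap.
From mathcomp Require Import boolp classical_sets reals.
From mathcomp Require Import ring lra zify.

Set Implicit Arguments.
Unset Strict Implicit.
Unset Printing Implicit Defensive.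

Import Order.TTheory GRing.Theory Num.Theory.

Local Open Scope ring_scope.

(** * Validity on finite sequences and the Gomory-Johnson characterization *)

(** Finitely supported multiplicities are finite sequences up to order, and sequences allow the
    terms of a solution to be dropped or replaced. *)
Lemma validP (R : realType) (G : zmodType) (b : G) (pi : G -> R) :
  valid b pi <->
  (forall x, 0 <= pi x) /\
  (forall s : seq G, \sum_(x <- s) x = b -> 1 <= \sum_(x <- s) pi x).
Proof.
split=> -[pi_ge0 pi_ge1]; split=> //.
- move=> s sb; pose y : {fsfun G -> nat with 0%N} :=
    [fsfun x in [fset z in s]%fset => count_mem x s].
  have yE x : y x = count_mem x s.
    by rewrite fsfunE !inE /=; case: ifPn => // /count_memPn ->.
  have sumE (V : nmodType) (F : G -> V) :
      \sum_(x <- finsupp y) F x *+ y x = \sum_(x <- s) F x.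
    rewrite -[RHS](big_undup_iterop_count _ _ xpredT) /=.
    rewrite (perm_big (undup s)) /=; last first.
      apply: uniq_perm; rewrite ?fset_uniq ?undup_uniq // => x.
      by rewrite mem_finsupp yE mem_undup -lt0n -has_count has_pred1.
    by apply: eq_bigr => x _; rewrite yE.
  rewrite -sumE; under eq_bigr do rewrite -mulr_natr.
  by apply: pi_ge1; rewrite /Isol /= sumE.
- move=> y yb; pose s := flatten [seq nseq (y x) x | x <- finsupp y].
  have sumE (V : nmodType) (F : G -> V) :
      \sum_(x <- s) F x = \sum_(x <- finsupp y) F x *+ y x.
    rewrite big_flatten big_map; apply: eq_bigr => x _.
    by rewrite big_nseq iter_addr_0.
  under eq_bigr do rewrite mulr_natr.
  by rewrite -sumE; apply: pi_ge1; rewrite sumE.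
Qed.

Definition gomory_johnson (R : realType) (G : zmodType) (b : G) (pi : G -> R) :=
  [/\ pi 0 = 0, (forall x y, pi (x + y) <= pi x + pi y)
    & (forall x, pi x + pi (b - x) = 1)].

Lemma subadditive_sum (R : realType) (G : zmodType) (pi : G -> R) (s : seq G) :
  pi 0 = 0 -> (forall x y, pi (x + y) <= pi x + pi y) ->
  pi (\sum_(x <- s) x) <= \sum_(x <- s) pi x.
Proof.
move=> pi0 piD; elim: s => [|x s IHs]; first by rewrite !big_nil pi0.
by rewrite !big_cons (le_trans (piD _ _)) // lerD2l.
Qed.

(** Subadditivity makes every solution cost at least [pi b = 1]. The solution [x, b - x] costs
    exactly 1, so neither of its values can be lowered. *)
Lemma gomory_johnson_minimal (R : realType) (G : zmodType) (b : G)
    (pi : G -> R) :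
  (forall x, 0 <= pi x) -> gomory_johnson b pi -> minimal_functions b pi.
Proof.
move=> pi_ge0 [pi0 piD piC]; split.
  apply/validP; split=> // s sb.
  by rewrite -(piC b) subrr pi0 addr0 -sb subadditive_sum.
move=> pi' /validP [_ pi'_ge1] pi'_le; apply/funext => x.
have := pi'_ge1 [:: x; b - x].
rewrite !big_cons !big_nil !addr0 subrKC => /(_ erefl).
have := piC x; have := pi'_le x; have := pi'_le (b - x); lra.
Qed.

Lemma minimal_gomory_johnson (R : realType) (G : zmodType) (b : G)
    (pi : G -> R) :
  minimal_functions b pi -> (forall x, 0 <= pi x) /\ gomory_johnson b pi.
Proof.
case=> /validP[pi_ge0 pi_ge1] pi_min.
(* Minimality at one point: if lowering [pi x0] to [a] preserves validity, then [pi x0] was already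
   [a]. *)
have lower x0 a : 0 <= a -> a <= pi x0 ->
    (forall s, \sum_(x <- s) x = b ->
      1 <= \sum_(x <- s) (if x == x0 then a else pi x)) -> pi x0 = a.
  move=> a_ge0 a_le ge1; pose pi' x := if x == x0 then a else pi x.
  suff <- : pi' = pi by rewrite /pi' eqxx.
  apply: pi_min => [|x]; last by rewrite /pi'; case: eqP => // ->.
  by apply/validP; split=> // x; rewrite /pi'; case: ifP.
(* Deleting the zeros from a solution leaves a solution, so the value at 0 can be lowered to 0. *)
have pi0 : pi 0 = 0.
  apply: lower => // s sb.
  under eq_bigr do rewrite -if_neg.
  rewrite -big_mkcond -big_filter; apply: pi_ge1.
  rewrite big_filter big_mkcond -[RHS]sb; apply: eq_bigr => x _.
  by case: eqP.
have piD x y : pi (x + y) <= pi x + pi y.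
  rewrite leNgt; apply/negP => ltD.
  have xz : x != x + y.
    by apply: contraTneq ltD => <-; rewrite -leNgt lerDl.
  have yz : y != x + y.
    by apply: contraTneq ltD => <-; rewrite -leNgt lerDr.
  suff eqD : pi (x + y) = pi x + pi y by rewrite eqD ltxx in ltD.
  apply: lower => [||s sb]; [by rewrite addr_ge0|exact: ltW|].
  (* Each occurrence of [x + y] is split into [x] and [y]; the total is still [b]. *)
  pose t := flatten [seq if z == x + y then [:: x; y] else [:: z] | z <- s].
  have sumE (V : nmodType) (F : G -> V) :
      \sum_(z <- t) F z = \sum_(z <- s) (if z == x + y then F x + F y else F z).
    rewrite big_flatten big_map; apply: eq_bigr => z _.
    by case: eqP => _ /=; rewrite !big_cons big_nil ?addr0.
  rewrite -sumE; apply: pi_ge1; rewrite sumE -sb; apply: eq_bigr => z _.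
  by case: eqP.
have piC_ge1 x : 1 <= pi x + pi (b - x).
  have := pi_ge1 [:: x; b - x].
  by rewrite !big_cons !big_nil !addr0 subrKC; apply.
(* Dividing [pi x] by [c] preserves validity: the other terms of a solution through [x] sum to
   [b - x], so its cost is at least [c]. Hence [pi x = pi x / c]. *)
have piC_gt1 x : 1 < pi x + pi (b - x) -> pi x = 0.
  set c := pi x + _ => c_gt1; have c_gt0 : 0 < c by lra.
  suff : pi x = pi x / c.
    move=> /(congr1 ( *%R^~ c)); rewrite divfK ?gt_eqF // => eqc.
    have /eqP : pi x * (c - 1) = 0 by lra.
    by rewrite mulf_eq0 => /orP[/eqP //|/eqP]; lra.
  apply: lower => [||s sb].
  - by rewrite divr_ge0 // ltW.
  - by rewrite ler_pdivrMr // ler_peMr // ltW.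
  have [xs|xNs] := boolP (x \in s); last first.
    rewrite (eq_big_seq pi) ?pi_ge1 // => z zs.
    by case: eqP xNs => // <-; rewrite zs.
  have le_s : c <= \sum_(z <- s) pi z.
    rewrite (perm_big _ (perm_to_rem xs)) big_cons lerD2l.
    apply: le_trans (subadditive_sum _ pi0 piD); rewrite -sb.
    by rewrite (perm_big _ (perm_to_rem xs)) big_cons addrAC subrr add0r.
  apply: (@le_trans _ _ ((\sum_(z <- s) pi z) / c)).
    by rewrite ler_pdivlMr // mul1r.
  rewrite mulr_suml; apply: ler_sum => z _.
  by case: eqP => [->//|_]; rewrite ler_pdivrMr // ler_peMr // ltW.
split=> //; split=> // x; apply/eqP; rewrite eq_le piC_ge1 andbT leNgt.
apply/negP => gt1.
(* Both [pi x] and [pi (b - x)] would vanish, against [piC_ge1]. *)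
have := piC_gt1 (b - x); rewrite subKr [pi _ + pi x]addrC => /(_ gt1).
have := piC_gt1 _ gt1; lra.
Qed.

(** * The Cauchy-Davenport inequality *)

Lemma card_Zq (q : nat) : (1 < q)%N -> #|'Z_q| = q.
Proof. by move=> q_gt1; rewrite card_ord Zp_cast. Qed.

Lemma unit_Zq (q : nat) (x : 'Z_q) : prime q -> x != 0 -> x \is a GRing.unit.
Proof.
move=> q_pr x_neq0; have q_gt1 := prime_gt1 q_pr.
rewrite -[x]natr_Zp unitZpE // prime_coprime //.
by rewrite gtnNdvd ?lt0n // -[ltnRHS](Zp_cast q_gt1).
Qed.

Lemma cauchy_davenport (q : nat) (A B : {set 'Z_q}) :
  prime q -> (0 < #|A|)%N -> (0 < #|B|)%N ->
  (minn q (#|A| + #|B|).-1 <= #|[set (x + y)%R | x in A, y in B]|)%N.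
Proof.
move=> q_pr; have q_gt1 := prime_gt1 q_pr.
have [n] := ubnP #|B|; elim: n => // n IHn in A B *.
rewrite ltnS => leBn A_gt0 B_gt0.
have [B_le1|] := leqP #|B| 1.
  have /cards1P[y ->] : #|B| == 1%N by rewrite eqn_leq B_le1.
  rewrite cards1 addn1 /= geq_min; apply/orP; right.
  rewrite -(card_imset (mem A) (addIr y)); apply: subset_leq_card.
  apply/fintype.subsetP => _ /imsetP[x xA ->]; apply/imset2P.
  by exists x y => //; rewrite inE.
move=> /card_gt1P[y1 [y2 [y1B y2B y12]]].
(* For [q] prime the nonzero [y2 - y1] generates the group, so a set [A] stable under this
   translation is everything. Otherwise some [a] in [A] leaves [A], and it defines the transform. *)
have [/forall_inP|] := boolP [forall x in A, x + (y2 - y1) \in A].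
  move=> closedA; have /card_gt0P[a aA] := A_gt0.
  have aD k : a + (y2 - y1) *+ k \in A.
    by elim: k => [|k IHk]; rewrite ?addr0 // mulrSr addrA closedA.
  have d_unit : y2 - y1 \is a GRing.unit.
    by apply: unit_Zq => //; rewrite subr_eq0 eq_sym.
  rewrite geq_min; apply/orP; left.
  rewrite -[leqLHS](card_Zq q_gt1) -cardsT; apply: subset_leq_card.
  apply/fintype.subsetP => z _; apply/imset2P.
  exists (z - y1) y1 => //; last by rewrite subrK.
  have := aD ((z - y1 - a) / (y2 - y1) : 'Z_q).
  by rewrite -mulr_natr natr_Zp mulrC divrK // subrKC.
move=> /forall_inPn[a aA aD].
(* Dyson's e-transform: [#|A'| + #|B'| = #|A| + #|B|] and [A' + B'] is contained
   in [A + B], while [y2] leaves [B]. *)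
pose e := a - y1.
pose A' := A :|: [set e + y | y in B]; pose B' := [set y in B | e + y \in A].
have y1B' : y1 \in B' by rewrite inE y1B /e subrK.
have ltB' : (#|B'| < #|B|)%N.
  apply: proper_card; apply/properP; split.
    by apply/fintype.subsetP => y; rewrite inE => /andP[].
  by exists y2 => //; rewrite inE y2B /e addrAC -addrA.
have cardE : (#|A'| + #|B'| = #|A| + #|B|)%N.
  rewrite cardsU (card_imset (mem B) (addrI e)).
  have -> : #|A :&: [set e + y | y in B]| = #|B'|.
    rewrite -(card_imset (mem B') (addrI e)); congr (#|pred_of_set _|).
    apply/finset.setP => z; rewrite inE; apply/andP/imsetP.
      by case=> zA /imsetP[y yB zE]; exists y; rewrite // inE yB -zE.
    case=> y; rewrite inE => /andP[yB yA] ->; split=> //.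
    exact: imset_f.
  rewrite subnK //; apply: leq_trans (leq_addl _ _).
  by apply: subset_leq_card; apply/fintype.subsetP => y; rewrite inE => /andP[].
rewrite -cardE; apply: leq_trans (IHn A' B' _ _ _) _.
- exact: leq_trans leBn.
- by apply/card_gt0P; exists a; rewrite inE aA.
- by apply/card_gt0P; exists y1.
apply: subset_leq_card; apply/fintype.subsetP => _ /imset2P[x y + + ->].
rewrite !inE => /orP[xA|/imsetP[z zB ->]] /andP[yB eyA].
  by apply/imset2P; exists x y.
by apply/imset2P; exists (e + y) z => //; rewrite -!addrA [z + y]addrC.
Qed.

(** * Majorization and the product bound for subadditive sequences *)

Lemma subadditive_partial_sum (R : realType) (n : nat) (v : nat -> R) (k : nat) :
  (0 < k <= n)%N ->
  (forall i j, (0 < i)%N -> (0 < j)%N -> (i + j <= n)%N ->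
     v (i + j)%N <= v i + v j) ->
  (\sum_(1 <= i < n.+1) v i) * (k * k.+1)%:R <=
    (\sum_(1 <= i < k.+1) v i) * (n * n.+1)%:R.
Proof.
move=> /andP[k_gt0 lekn] vD; pose S j := \sum_(1 <= i < j.+1) v i.
have S_ge j : (0 < j < n)%N -> v j.+1 * j%:R <= 2 * S j.
  move=> /andP[j_gt0 ltjn].
  have -> : v j.+1 * j%:R = \sum_(1 <= i < j.+1) v j.+1.
    by rewrite sumr_const_nat subn1 mulr_natr.
  (* Pairs [i] with [j + 1 - i]; the index is in the shape that reversing the sum produces. *)
  have -> : 2 * S j = \sum_(1 <= i < j.+1) (v i + v (1 + j.+1 - i.+1)%N).
    by rewrite mulr_natl mulr2n {2}/S big_nat_rev -big_split.
  apply: ler_sum_nat => i /andP[i_gt0 leij].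
  have {1}-> : j.+1 = (i + (1 + j.+1 - i.+1))%N by lia.
  by apply: vD; lia.
rewrite -/(S n) -/(S k).
elim: n lekn S_ge {vD} => [|n IHn] lekn S_ge; first by lia.
have [->//|ltkn] := eqVneq k n.+1.
have {}IHn : S n * (k * k.+1)%:R <= S k * (n * n.+1)%:R.
  by apply: IHn => [|j /andP[j0 jn]]; [lia|apply: S_ge; lia].
have n_gt0 : (0 < n)%N by lia.
have Sn : S n.+1 = S n + v n.+1 by rewrite /S big_nat_recr.
have := S_ge n; rewrite n_gt0 ltnSn => /(_ isT) vn.
(* One step of the monotonicity of [S k / (k (k + 1))], with the common factor [n + 1] cancelled. *)
have leS : S n.+1 * n%:R <= S n * n.+2%:R.
  by rewrite Sn -[in n.+2%:R]addn2 natrD; lra.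
rewrite -(ler_pM2r (_ : 0 < n%:R)) ?ltr0n //.
apply: (@le_trans _ _ (S n * n.+2%:R * (k * k.+1)%:R)).
  by rewrite mulrAC ler_wpM2r.
rewrite mulrAC (_ : _ * (n.+1 * n.+2)%:R * _ = S k * (n * n.+1)%:R * n.+2%:R).
  by rewrite ler_wpM2r.
by rewrite !natrM; ring.
Qed.

(* Abel summation: the partial sums of [w - v] are nonpositive and [1 / v] is
   nonincreasing. *)
Lemma sum_ratio_le (R : realType) (n : nat) (v w : nat -> R) :
  (forall i, (0 < i <= n)%N -> 0 < v i) ->
  (forall i, (0 < i < n)%N -> v i <= v i.+1) ->
  (forall k, (0 < k <= n)%N ->
     \sum_(1 <= i < k.+1) w i <= \sum_(1 <= i < k.+1) v i) ->
  \sum_(1 <= i < n.+1) w i = \sum_(1 <= i < n.+1) v i ->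
  \sum_(1 <= i < n.+1) w i / v i <= n%:R.
Proof.
move=> v_gt0 v_incr w_le w_eq.
pose D k := \sum_(1 <= i < k.+1) (w i - v i).
have DE k : D k = \sum_(1 <= i < k.+1) w i - \sum_(1 <= i < k.+1) v i.
  by rewrite /D sumrB.
(* The boundary term [D k / v k] makes the induction work and vanishes at [k = n], where the two
   sums agree. *)
suff abel k : (0 < k <= n)%N ->
    \sum_(1 <= i < k.+1) w i / v i <= k%:R + D k / v k.
  have [->|n_gt0] := posnP n; first by rewrite big_geq.
  by have := abel n; rewrite n_gt0 leqnn DE w_eq subrr mul0r addr0; apply.
elim: k => [//|k IHk] /andP[_ ltkn].
have vS_gt0 : 0 < v k.+1 by apply: v_gt0.
have DS : D k.+1 = D k + (w k.+1 - v k.+1) by rewrite /D big_nat_recr.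
have Dw : D k.+1 / v k.+1 = D k / v k.+1 + w k.+1 / v k.+1 - 1.
  by rewrite DS; field; rewrite gt_eqF.
rewrite big_nat_recr //= Dw -natr1.
(* The case [k = 0] is separate because nothing is assumed about [v 0]. *)
have [k0|k_gt0] := posnP k.
  by rewrite k0 big_geq // /D big_geq // mul0r; lra.
have vk_gt0 : 0 < v k by apply: v_gt0; lia.
have {}IHk := IHk _; rewrite k_gt0 (ltnW ltkn) in IHk; have {}IHk := IHk isT.
suff : D k / v k <= D k / v k.+1 by lra.
rewrite ler_wnM2l //; first by rewrite DE subr_le0 w_le // k_gt0 ltnW.
by rewrite lef_pV2 ?posrE // v_incr // k_gt0.
Qed.

Lemma prod_factorial (R : realType) (n : nat) :
  \prod_(1 <= i < n.+1) (i%:R / n%:R) = n`!%:R / n%:R ^+ n :> R.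
Proof.
by rewrite prodf_div prodr_const_nat subn1 -natr_prod -fact_prod.
Qed.

Lemma sum_ramp (R : realType) (n k : nat) :
  \sum_(1 <= i < k.+1) (i%:R / n%:R) = (k * k.+1)%:R / (2 * n%:R) :> R.
Proof.
rewrite -mulr_suml invfM mulrA; congr (_ / _).
elim: k => [|k IHk]; first by rewrite big_geq // mul0r.
by rewrite big_nat_recr //= IHk !natrM -!natr1; field.
Qed.

Lemma subadditive_prod (R : realType) (n : nat) (v : nat -> R) :
  (forall i, (0 < i < n)%N -> v i <= v i.+1) ->
  (forall i j, (0 < i)%N -> (0 < j)%N -> (i + j <= n)%N ->
     v (i + j)%N <= v i + v j) ->
  \sum_(1 <= i < n.+1) v i = n.+1%:R / 2 ->
  n`!%:R / n%:R ^+ n <= \prod_(1 <= i < n.+1) v i /\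
  (\prod_(1 <= i < n.+1) v i = n`!%:R / n%:R ^+ n ->
   forall i, (0 < i <= n)%N -> v i = i%:R / n%:R).
Proof.
move=> v_incr vD v_sum.
have [->|n_gt0] := posnP n.
  by split=> [|_ i]; [rewrite big_geq // fact0 expr0 divr1|lia].
have nR_gt0 : 0 < n%:R :> R by rewrite ltr0n.
pose w i : R := i%:R / n%:R.
have w_gt0 i : (0 < i)%N -> 0 < w i by move=> i0; rewrite divr_gt0 ?ltr0n.
have w_le k : (0 < k <= n)%N ->
    \sum_(1 <= i < k.+1) w i <= \sum_(1 <= i < k.+1) v i.
  move=> kn; have := subadditive_partial_sum kn vD.
  rewrite v_sum sum_ramp ler_pdivrMr ?mulr_gt0 //.
  rewrite natrM => H; rewrite -(ler_pM2r (_ : 0 < n.+1%:R / 2)) ?divr_gt0 ?ltr0n //.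
  rewrite [leLHS]mulrC; apply: le_trans H _.
  by rewrite natrM le_eqVlt; apply/orP; left; apply/eqP; field.
have w_eq : \sum_(1 <= i < n.+1) w i = \sum_(1 <= i < n.+1) v i.
  by rewrite v_sum sum_ramp natrM; field; rewrite gt_eqF.
(* The bound [w_le] at [k = 1] gives [v 1 >= 1 / n > 0], and monotonicity does the rest. *)
have v_gt0 i : (0 < i <= n)%N -> 0 < v i.
  elim: i => [//|[_ _|i IHi iln]].
    have := w_le 1%N; rewrite !big_nat1 n_gt0 => /(_ isT).
    by apply: lt_le_trans; apply: w_gt0.
  by apply: lt_le_trans (IHi _) (v_incr _ _); lia.
have ratio_le := sum_ratio_le v_gt0 v_incr w_le w_eq.
pose E (i : 'I_n) := w i.+1 / v i.+1.
have E_gt0 i : 0 < E i.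
  by rewrite /E divr_gt0 ?w_gt0 ?v_gt0 //=.
have sumE : \sum_(i in 'I_n) E i <= n%:R.
  by move: ratio_le; rewrite big_add1 big_mkord.
have prodE : \prod_(i in 'I_n) E i =
    (n`!%:R / n%:R ^+ n) / \prod_(1 <= i < n.+1) v i.
  rewrite -prod_factorial [in RHS]big_add1 [X in _ / X]big_add1 /= !big_mkord.
  by rewrite -prodf_div.
have prodv_gt0 : 0 < \prod_(1 <= i < n.+1) v i.
  by rewrite big_add1 big_mkord prodr_gt0 // => i _; apply: v_gt0 => /=.
have mean_ge0 : 0 <= (\sum_(i in 'I_n) E i) / n%:R.
  by rewrite divr_ge0 // sumr_ge0 // => i _; apply: ltW.
have mean_le : ((\sum_(i in 'I_n) E i) / n%:R) ^+ n <= 1.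
  by rewrite exprn_ile1 // ler_pdivrMr // mul1r.
have := @leif_AGM _ _ 'I_n E (fun i _ => ltW (E_gt0 i)).
rewrite card_ord prodE => -[AGM AGMeq].
split.
  by move: (le_trans AGM mean_le); rewrite ler_pdivrMr // mul1r.
move=> prodv; move: AGM AGMeq.
rewrite prodv divff; last by rewrite -prodv gt_eqF.
(* The product of the ratios is 1 and their mean is at most 1, so AM-GM is an equality and all
   ratios coincide. *)
move=> AGM; rewrite eq_le AGM mean_le => /esym/forall_inP Econst.
have i0 : 'I_n by exists 0%N.
have Eeq i : E i = E i0 by apply/eqP; apply: (forall_inP (Econst i isT)).
(* The common ratio is 1 because [w] and [v] have the same positive total. *)
have E0 : E i0 = 1.
  suff Esum : \sum_(i < n) w i.+1 = E i0 * \sum_(i < n) w i.+1.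
    have Sgt0 : 0 < \sum_(i < n) w i.+1.
      have := w_eq; rewrite v_sum big_add1 big_mkord => ->.
      by rewrite divr_gt0 ?ltr0n.
    by apply: (mulIf (lt0r_neq0 Sgt0)); rewrite mul1r.
  have := w_eq; rewrite !big_add1 !big_mkord /= => w_eq'.
  rewrite {2}w_eq' mulr_sumr; apply: eq_bigr => i _.
  by rewrite -(Eeq i) /E divfK // gt_eqF // v_gt0 /=.
move=> [//|i] /andP[_ ltin].
have := Eeq (Ordinal ltin); rewrite E0 /E /= => /(congr1 ( *%R^~ (v i.+1))).
by rewrite mul1r divfK // gt_eqF // v_gt0.
Qed.

(** * The product bound for functions on the cyclic group *)

Lemma sum_gomory_johnson (R : realType) (q : nat) (b : 'Z_q) (pi : 'Z_q -> R) :
  (1 < q)%N -> gomory_johnson b pi -> \sum_x pi x = q%:R / 2.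
Proof.
move=> q_gt1 [_ _ piC]; set S := LHS.
suff : S + S = q%:R by lra.
have inv_b : involutive (fun x : 'Z_q => b - x) by move=> x; rewrite subKr.
rewrite {2}/S (reindex_inj (inv_inj inv_b)) -big_split /=.
by under eq_bigr do rewrite piC; rewrite sumr_const card_Zq.
Qed.

Lemma gomory_johnson_prod (R : realType) (q : nat) (b : 'Z_q)
    (pi : 'Z_q -> R) :
  prime q -> (forall x, 0 <= pi x) -> gomory_johnson b pi ->
  (q.-1)`!%:R / (q.-1)%:R ^+ q.-1 <= \prod_(x | x != 0) pi x /\
  (\prod_(x | x != 0) pi x = (q.-1)`!%:R / (q.-1)%:R ^+ q.-1 ->
   exists x, pi x = (q.-1)%:R^-1).
Proof.
move=> q_pr pi_ge0 pi_gj; have q_gt1 := prime_gt1 q_pr.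
have [pi0 piD piC] := pi_gj.
pose l := [seq pi x | x in predC1 (0 : 'Z_q)].
(* The leading 0 is [pi 0], so [v 0 = 0] and the nonzero arguments fill the indices 1 to [q - 1]. *)
pose s := 0 :: sort <=%R l; pose v i := nth 0 s i.
have s_perm : perm_eq s (codom pi).
  rewrite /s -{1}pi0 (perm_trans (y := pi 0 :: l)) ?perm_cons ?perm_sort //.
  apply: (perm_map pi (s := 0 :: _)); apply: uniq_perm => [||x].
  - by rewrite /= enum_uniq andbT mem_enum inE eqxx.
  - by rewrite enum_uniq.
  - by rewrite !inE !mem_enum !inE orbN.
have size_s : size s = q by rewrite (perm_size s_perm) size_codom card_Zq.
have s_sorted : sorted <=%R s.
  rewrite /s /= path_min_sorted ?sort_le_sorted //.
  by apply/allP => _ /[!mem_sort]/mapP[x _ ->].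
pose A t := [set x | pi x <= t].
have countE t : count (<= t) s = #|A t|.
  rewrite (seq.permP s_perm) cardsE cardE -size_filter /codom /image_mem.
  rewrite filter_map size_map /enum_mem -filter_predI; congr (size _).
  by apply: eq_filter => x; rewrite !inE andbT.
have count_v i : (i < q)%N -> (i < #|A (v i)|)%N.
  move=> ltiq; rewrite -countE ltnNge; apply/negP => le_i.
  have := @nth_count_gt _ _ (v i) 0 s i s_sorted.
  by rewrite le_i size_s ltiq ltxx => /(_ isT).
have v_le i t : (i < #|A t|)%N -> v i <= t.
  by rewrite -countE; apply: nth_count_le.
have vD i j : (0 < i)%N -> (0 < j)%N -> (i + j <= q.-1)%N ->
    v (i + j)%N <= v i + v j.
  move=> _ _ leij; apply: v_le.
  have iA : (i < #|A (v i)|)%N by apply: count_v; lia.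
  have jA : (j < #|A (v j)|)%N by apply: count_v; lia.
  have := cauchy_davenport q_pr (leq_ltn_trans _ iA) (leq_ltn_trans _ jA).
  move=> /(_ isT isT) CD.
  (* The sumset of the two sublevel sets has more than [i + j] elements and lies in the sublevel set
     at [v i + v j]. *)
  apply: (@leq_trans (minn q (#|A (v i)| + #|A (v j)|).-1)); first by lia.
  apply: leq_trans CD _; apply: subset_leq_card.
  apply/fintype.subsetP => _ /imset2P[x y + + ->]; rewrite !inE => xi yj.
  by rewrite (le_trans (piD _ _)) // lerD.
have v_incr i : (0 < i < q.-1)%N -> v i <= v i.+1.
  by move=> iq; apply: (sorted_leq_nth le_trans le_refl) => //; rewrite ?inE ?size_s; lia.
have q_eq : q.-1.+1 = q by lia.
(* Stated for any commutative law so as to serve both the sum and the product. *)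
have bigE (idx : R) (op : Monoid.com_law idx) :
    \big[op/idx]_(1 <= i < q) v i = \big[op/idx]_(x | x != 0) pi x.
  have -> : \big[op/idx]_(x | x != 0) pi x = \big[op/idx]_(a <- sort <=%R l) a.
    by rewrite (perm_big l) ?perm_sort //= big_image.
  have size_l : size (sort <=%R l) = q.-1 := congr1 predn size_s.
  by rewrite -q_eq big_add1 -size_l [RHS](big_nth 0).
have v_sum : \sum_(1 <= i < q.-1.+1) v i = q.-1.+1%:R / 2.
  rewrite q_eq bigE -(sum_gomory_johnson q_gt1 pi_gj) [RHS](bigD1 0) //=.
  by rewrite pi0 add0r.
have := subadditive_prod v_incr vD v_sum; rewrite q_eq bigE.
case=> prod_ge prod_eq; split=> // /prod_eq /(_ 1%N) v1.
have : v 1%N \in codom pi by rewrite -(perm_mem s_perm) mem_nth ?size_s.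
by move=> /codomP[x vx]; exists x; rewrite -vx v1 ?div1r //; lia.
Qed.

(** * The Gomory function, its automorphic copies and uniqueness *)

Lemma natr_pred_Zq (q : nat) : (1 < q)%N -> (q.-1)%:R = -1 :> 'Z_q.
Proof.
move=> q_gt1; apply/eqP; rewrite -addr_eq0 natr1 prednK ?(ltnW q_gt1) //.
by rewrite pchar_Zp.
Qed.

Lemma GOM_gomory_johnson (R : realType) (q : nat) :
  (1 < q)%N -> gomory_johnson (-1) (GOM R q).
Proof.
move=> q_gt1; have n_gt0 : 0 < (q.-1)%:R :> R by rewrite ltr0n; lia.
split=> [|x y|x].
- by rewrite /GOM mul0r.
- rewrite /GOM -mulrDl ler_pM2r ?invr_gt0 // -natrD ler_nat.
  exact: leq_mod.
- rewrite /GOM -mulrDl -natrD; suff -> : (x + (- 1 - x)%R = q.-1)%N.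
    by rewrite divff // gt_eqF.
  have ltq (z : 'Z_q) : (z < q)%N by rewrite -[ltnRHS](Zp_cast q_gt1).
  have valD (y z : 'Z_q) : nat_of_ord (y + z) = ((y + z) %% q)%N.
    by congr (_ %% _)%N; apply: Zp_cast.
  have /(congr1 (@nat_of_ord _)) : x + (-1 - x) = (q.-1)%:R.
    by rewrite natr_pred_Zq // subrKC.
  move: (-1 - x) => z; rewrite val_Zp_nat // (@modn_small q.-1) ?valD; last by lia.
  move: (ltq x) (ltq z); move: (nat_of_ord x) (nat_of_ord z) => a c lta ltc.
  (* No carry occurs: if [a + c >= q], the residue [a + c - q] is at most [q - 2], not [q - 1]. *)
  have [le_q|lt_q] := leqP q (a + c); last by rewrite modn_small.
  by rewrite -(subnK le_q) modnDr modn_small; lia.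
Qed.

Lemma GOM_prod (R : realType) (q : nat) :
  (1 < q)%N ->
  \prod_(x | x != 0) GOM R q x = (q.-1)`!%:R / (q.-1)%:R ^+ q.-1.
Proof.
case: q => [|[|p]] //= _; rewrite -prod_factorial big_add1 big_mkord.
by rewrite big_mkcond big_ord_recl /= mul1r.
Qed.

Lemma gomory_johnson_comp (R : realType) (q : nat) (b : 'Z_q)
    (phi : 'Z_q -> 'Z_q) :
  (1 < q)%N -> {morph phi : x y / x + y} -> phi b = -1 ->
  gomory_johnson b (GOM R q \o phi).
Proof.
move=> q_gt1 phiD phib; have [GOM0 GOMD GOMC] := GOM_gomory_johnson R q_gt1.
have phi0 : phi 0 = 0 by apply: (addrI (phi 0)); rewrite -phiD !addr0.
have phiN x : phi (- x) = - phi x.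
  by apply: (addrI (phi x)); rewrite -phiD !subrr.
by split=> [|x y|x] /=; rewrite ?phi0 ?phiD ?phiN ?phib.
Qed.

Lemma gomory_johnson_GOM (R : realType) (q : nat) (b x : 'Z_q)
    (pi : 'Z_q -> R) :
  prime q -> gomory_johnson b pi -> pi x = (q.-1)%:R^-1 ->
  pi = GOM R q \o (fun y => - (y / b)).
Proof.
move=> q_pr pi_gj pix; have q_gt1 := prime_gt1 q_pr.
have [pi0 piD piC] := pi_gj; have GOM_gj := GOM_gomory_johnson R q_gt1.
have n_gt0 : 0 < (q.-1)%:R :> R by rewrite ltr0n; lia.
have x_unit : x \is a GRing.unit.
  apply: unit_Zq => //; apply: contra_eq_neq pix => ->.
  by rewrite pi0 eq_sym gt_eqF // invr_gt0.
have pi_le (z : 'Z_q) : pi (x * z) <= GOM R q z.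
  rewrite -{1}[z]natr_Zp mulr_natr /GOM.
  elim: (nat_of_ord z) => [|k IHk]; first by rewrite mulr0n pi0 mul0r.
  rewrite mulrSr (le_trans (piD _ _)) // -natr1 mulrDl lerD //.
  by rewrite pix mul1r.
have pi_eq (z : 'Z_q) : pi (x * z) = GOM R q z.
  apply/esym/eqP; rewrite -subr_eq0; apply/eqP.
  pose d z := GOM R q z - pi (x * z).
  have d_ge0 i : true -> 0 <= d i by rewrite subr_ge0.
  (* The differences are nonnegative and their sum is [q / 2 - q / 2 = 0]. *)
  apply: (psumr_eq0P d_ge0) => //; rewrite sumrB.
  have -> : \sum_z pi (x * z) = \sum_z pi z.
    by rewrite [RHS](reindex_inj (mulrI x_unit)).
  rewrite (sum_gomory_johnson q_gt1 GOM_gj) (sum_gomory_johnson q_gt1 pi_gj).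
  exact: subrr.
(* [pi b = 1], and [GOM] takes the value 1 only at [q - 1], so [b / x = -1]. *)
have xb : b = - x.
  have : GOM R q (b / x) = 1.
    by rewrite -pi_eq mulrC divrK // -(piC b) subrr pi0 addr0.
  rewrite /GOM => /(congr1 ( *%R^~ (q.-1)%:R)); rewrite divfK ?gt_eqF // mul1r.
  move=> /eqP; rewrite eqr_nat => /eqP bx.
  by rewrite -[b](divrK x_unit) -[b / x]natr_Zp bx natr_pred_Zq // mulN1r.
apply/funext => y /=; rewrite -pi_eq; congr pi.
by rewrite xb invrN (mulrN y) opprK mulrC divrK.
Qed.

Theorem theorem2p2 (R : realType) (q : nat) (b : 'Z_q) :
  prime q -> b != 0 ->
  inf [set \prod_(x : 'Z_q | x != 0) pi x | pi in @minimal_functions R _ b]%classic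
    = (q.-1)`!%:R / (q.-1)%:R ^+ q.-1
  /\
  exists phi : {perm 'Z_q},
    unique (fun f : {perm 'Z_q} =>
              f \in Aut [set: 'Z_q] /\ f b = (q.-1)%:R) phi
    /\
    forall pi : 'Z_q -> R,
      (minimal_functions b pi /\
       \prod_(x : 'Z_q | x != 0) pi x =
         inf [set \prod_(x : 'Z_q | x != 0) pi' x
             | pi' in @minimal_functions R _ b]%classic)
      <-> pi = GOM R q \o phi.
Proof.
move=> q_pr b_neq0; have q_gt1 := prime_gt1 q_pr.
have b_unit := unit_Zq q_pr b_neq0.
(* Since [q - 1 = -1], the automorphism sending [b] to [q - 1] is multiplication by [-1 / b]. *)
have phi_inj : injective (fun x : 'Z_q => - (x / b)).
  by move=> x y /oppr_inj/divIr; apply.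
have phiD : {morph (fun x : 'Z_q => - (x / b)) : x y / x + y}.
  by move=> x y; rewrite mulrDl opprD.
have phi_b : - (b / b) = -1 by rewrite divrr.
have phi_min : minimal_functions b (GOM R q \o (fun x : 'Z_q => - (x / b))).
  apply: gomory_johnson_minimal => [x|]; first by rewrite divr_ge0.
  exact: gomory_johnson_comp.
have phi_prod : \prod_(x | x != 0) (GOM R q \o (fun x : 'Z_q => - (x / b))) x =
    (q.-1)`!%:R / (q.-1)%:R ^+ q.-1.
  rewrite -GOM_prod // [RHS](reindex_inj phi_inj); apply: eq_bigl => x.
  by rewrite oppr_eq0 -[X in _ = (_ != X)](mul0r b^-1) (inj_eq (divIr b_unit)).
set val := _ / _; set S := (X in inf X).
have inf_S : inf S = val.
  apply/eqP; rewrite eq_le; apply/andP; split.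
    apply: ge_inf; last by exists (GOM R q \o (fun x : 'Z_q => - (x / b))).
    exists val => _ [pi /minimal_gomory_johnson[pi_ge0 pi_gj] <-].
    by have [] := gomory_johnson_prod q_pr pi_ge0 pi_gj.
  apply: lb_le_inf; first by exists val, (GOM R q \o (fun x : 'Z_q => - (x / b))).
  move=> _ [pi /minimal_gomory_johnson[pi_ge0 pi_gj] <-].
  by have [] := gomory_johnson_prod q_pr pi_ge0 pi_gj.
split=> //; exists (perm phi_inj); split.
  split=> [|f [f_aut fb]].
    split; last by rewrite permE phi_b natr_pred_Zq.
    rewrite inE; apply/andP; split; first by apply/fintype.subsetP => x; rewrite inE.
    by apply/morphicP => x y _ _; rewrite !permE; apply: phiD.
  (* Every [x] is a multiple of [b], so an automorphism is determined by its value at [b]. *)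
  apply/permP => x; rewrite permE.
  have fX k : f (b *+ k) = f b *+ k.
    by have := morphX (autm_morphism f_aut) k (finset.in_setT b).
  rewrite -{2}[x](divrK b_unit) -[x / b]natr_Zp mulr_natl fX fb natr_pred_Zq //.
  by rewrite mulNrn.
move=> pi; have -> : GOM R q \o perm phi_inj = GOM R q \o (fun x : 'Z_q => - (x / b)).
  by apply/funext => x /=; rewrite permE.
rewrite inf_S; split=> [[/minimal_gomory_johnson[pi_ge0 pi_gj] pi_prod]|->//].
have [_ /(_ pi_prod)[x pix]] := gomory_johnson_prod q_pr pi_ge0 pi_gj.
exact: gomory_johnson_GOM pix.
Qed.
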